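(* Let $n$ be a positive integer, $q:\{1,\dots,n\}\to\mathbb{R}$ a function, and let $X_1,X_2,\dots$ be independent identically distributed continuous random variables with relative ranks $R_t$ and absolute ranks $A_{t,n}$ (defined in the context). For $t=1,\dots,n$ define $$I_{t,n}(r)=\sum_{a=r}^{n-t+r} q(a)\,\frac{\binom{a-1}{r-1}\binom{n-a}{t-r}}{\binom{n}{t}},\quad r=1,\dots,t,\qquad Y_t:=I_{t,n}(R_t).$$ Let $\tau_*\in\mathscr T(\mathscr Y)$ be an optimal stopping rule for the sequence $Y_1,\dots,Y_n$, i.e. $\mathrm{E}\,Y_{\tau_*}=\max_{\tau\in\mathscr T(\mathscr Y)}\mathrm{E}\,Y_\tau$. Then $\tau_*$ also solves the problem of maximizing $\mathrm{E}\,q(A_{\tau,n})$ over $\tau\in\mathscr T(\mathscr R)$, and $$\mathrm{E}\,q(A_{\tau_*,n})=\max_{\tau\in\mathscr T(\mathscr R)}\mathrm{E}\,q(A_{\tau,n})=\max_{\tau\in\mathscr T(\mathscr Y)}\mathrm{E}\,Y_\tau=\mathrm{E}\,Y_{\tau_*}.$$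
   Context: Ranks: $R_t:=\sum_{j=1}^t\mathbf 1(X_t\le X_j)$ is the relative rank of $X_t$ and $A_{t,n}:=\sum_{j=1}^n\mathbf 1(X_t\le X_j)$ is its absolute rank among the first $n$ observations, $t=1,\dots,n$ (so the largest observation has rank one). ''Continuous'' means that the common distribution function of the $X_t$ is continuous. Filtrations: $\mathscr R_t=\sigma(R_1,\dots,R_t)$, $\mathscr R=(\mathscr R_t,1\le t\le n)$; $\mathscr Y_t=\sigma(Y_1,\dots,Y_t)$, $\mathscr Y=(\mathscr Y_t,1\le t\le n)$. For a filtration $\mathscr G=(\mathscr G_t,1\le t\le n)$, $\mathscr T(\mathscr G)$ is the set of all stopping times $\tau$ with values in $\{1,\dots,n\}$ such that $\{\tau=t\}\in\mathscr G_t$ for all $1\le t\le n$. *)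

(* Defs.v *)
From mathcomp Require Export all_boot all_order all_algebra finmap.
From mathcomp Require Export all_classical all_reals all_analysis.
Export Order.TTheory GRing.Theory Num.Theory.
Export numFieldNormedType.Exports.

Set Implicit Arguments.
Unset Strict Implicit.
Unset Printing Implicit Defensive.

Local Open Scope classical_set_scope.
Local Open Scope ring_scope.

(* Sequences are indexed from 1: the terms of index 0 of the sequences below are
   never used, and nothing is assumed about X 0. *)

Definition independent_seq d (T : measurableType d) (R : realType)
    (P : probability T R) (X : nat -> {RV P >-> R}) : Prop :=
  forall (J : {fset nat}) (B : nat -> set R),
    (forall j, j \in J -> (0 < j)%N) ->
    (forall j, j \in J -> measurable (B j)) ->
    P (\bigcap_(j in [set` J]) (X j @^-1` B j)) =
    (\prod_(j <- J) P (X j @^-1` B j))%E.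

Definition identically_distributed d (T : measurableType d) (R : realType)
    (P : probability T R) (X : nat -> {RV P >-> R}) : Prop :=
  forall s t, (0 < s)%N -> (0 < t)%N ->
    forall B : set R, measurable B ->
    distribution P (X s) B = distribution P (X t) B.

Definition relative_rank d (T : measurableType d) (R : realType)
    (P : probability T R) (X : nat -> {RV P >-> R}) (t : nat) (w : T) : nat :=
  (\sum_(1 <= j < t.+1) (X t w <= X j w)%R)%N.

Definition absolute_rank d (T : measurableType d) (R : realType)
    (P : probability T R) (X : nat -> {RV P >-> R}) (n t : nat) (w : T) : nat :=
  (\sum_(1 <= j < n.+1) (X t w <= X j w)%R)%N.

(* sigma(Z_1, ..., Z_t). *)
Definition natural_filtration (T : pointedType) d' (E : measurableType d')
    (Z : nat -> T -> E) (t : nat) : set (set T) :=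
  <<s \bigcup_(s in [set s | (0 < s <= t)%N]) g_sigma_algebra_preimage (Z s) >>.

Definition stopping_times (T : Type) (n : nat) (G : nat -> set (set T)) :
    set (T -> nat) :=
  [set tau | (forall w, (0 < tau w <= n)%N) /\
    forall t, (0 < t <= n)%N -> G t [set w | tau w = t]].

Definition expected_stopped d (T : measurableType d) (R : realType)
    (P : probability T R) (Z : nat -> T -> R) (tau : T -> nat) : \bar R :=
  ('E_P[fun w => Z (tau w) w])%E.

(* q : {1, ..., n} -> R is represented by a function on nat, only whose values
   on {1, ..., n} matter. For 1 <= r <= t <= n the weights are the conditional
   law of the absolute rank at time t given that the relative rank is r. *)
Definition rank_reward (R : realType) (q : nat -> R) (n t r : nat) : R :=
  \sum_(r <= a < (n - t + r).+1)
    q a * (('C(a - 1, r - 1) * 'C(n - a, t - r))%N%:R / 'C(n, t)%:R).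

Definition maximum_of (R : realType) (E : set (\bar R)) (v : \bar R) : Prop :=
  E v /\ ubound E v.

Definition maximizer (U : Type) (R : realType) (S : set U) (f : U -> \bar R)
    (x : U) : Prop :=
  S x /\ maximum_of (f @` S) (f x).

(* Main.v *)
Require Import Defs.
From HB Require Import structures.
From mathcomp Require Import measurable_realfun zify ring.

(* Almost surely there are no ties, and then the relative ranks R_1, ..., R_n
   determine the order of X_1, ..., X_n. By exchangeability all orders are
   equally likely, so each event {R_1 = r_1, ..., R_t = r_t} with 1 <= r_i <= i
   is cut by R_{t+1} into t + 1 parts of equal probability. Along this tree the
   absolute rank evolves as a -> a + 1(R_{t+1} <= a), and rank_reward solves the
   resulting backward recursion; hence E(q(A_{t,n}) | R_1, ..., R_t) = Y_t, and
   q(A_{tau,n}) and Y_tau have the same expectation for every tau in T(R).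
   Backward induction on the tree bounds E Y_tau over T(R) by a number which is
   attained by stopping as soon as Y_t reaches the optimal value of continuing.
   This rule belongs to T(Y), so the larger class T(R) has the same maximum. *)

Set Implicit Arguments.
Unset Strict Implicit.
Unset Printing Implicit Defensive.

Local Open Scope classical_set_scope.
Local Open Scope ring_scope.

(** * Exchangeability and absence of ties *)

Definition tuple_box (T : Type) k (B : 'I_k -> set T) : set (k.-tuple T) :=
  [set x | forall i, B i (tnth x i)].

(** Boxes, unlike preimages under single coordinates, are closed under intersection, so finite
    measures that agree on them coincide. *)
Lemma measurable_tupleE d (T : measurableType d) k :
  @measurable _ (k.-tuple T) =
  <<s [set tuple_box B | B in [set B : 'I_k -> set T |
                                forall i, measurable (B i)]] >>.
Proof.
apply/seteqP; split.
- apply: smallest_sub; first exact: smallest_sigma_algebra.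
  rewrite -bigcup_seq => S [i /= _ [B mB <-]]; rewrite setTI.
  apply: sub_sigma_algebra; exists (fun j => if j == i then B else setT).
    by move=> j /=; case: ifP.
  apply/seteqP; split=> x /=; first by move/(_ i); rewrite eqxx.
  by move=> Bx j; case: eqP => // ->.
- apply: smallest_sub; first exact: sigma_algebra_measurable.
  move=> _ [B mB <-].
  rewrite (_ : tuple_box B = \bigcap_(i in setT) ((@tnth k T ^~ i) @^-1` B i)).
    apply: fin_bigcap_measurable => // i _.
    by rewrite -[_ @^-1` _]setTI; exact: measurable_tnth.
  by apply/seteqP; split=> x /= Bx; [move=> i _|move=> i]; exact: Bx.
Qed.

Section iid.
Context d (T : measurableType d) (R : realType) (P : probability T R).
Variable X : nat -> {RV P >-> R}.
Hypothesis indX : independent_seq X.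
Hypothesis idX : identically_distributed X.
Hypothesis ctsX : forall t, (0 < t)%N -> continuous (cdf (X t)).

Definition subsample k (l : k.-tuple nat) (w : T) : k.-tuple R :=
  [tuple X (tnth l i) w | i < k].

Lemma measurable_subsample k (l : k.-tuple nat) :
  measurable_fun setT (subsample l).
Proof.
apply/measurable_fun_tnthP => i.
rewrite (_ : _ \o _ = X (tnth l i)); first exact: measurable_funPT.
by apply/funext => w /=; rewrite tnth_mktuple.
Qed.

HB.instance Definition _ k (l : k.-tuple nat) :=
  isMeasurableFun.Build _ _ _ _ (subsample l) (measurable_subsample l).

Lemma subsample_box k (l : k.-tuple nat) (B : 'I_k -> set R) :
  uniq l -> all (leq 1) l -> (forall i, measurable (B i)) ->
  distribution P (subsample l) (tuple_box B) =
  (\prod_(i < k) distribution P (X 1%N) (B i))%E.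
Proof.
move=> ul l0 mB.
(* Independence is stated by observation index, the sides of a box by position. As [l] is
   duplicate-free, [B' j] is the one side attached to [j] when [j] is in [l]. *)
pose B' j := \bigcap_(i in [set i | tnth l i = j]) B i.
have B'E i : B' (tnth l i) = B i.
  apply/seteqP; split=> [x /(_ i)|x Bx j]; first exact.
  by move=> /(tuple_uniqP _ ul) ->.
have := @indX [fset x | x in (l : seq nat)]%fset B' _ _.
rewrite (_ : \bigcap_(j in _) _ = subsample l @^-1` tuple_box B); last first.
  apply/seteqP; split=> w.
    move=> Bw i; rewrite tnth_mktuple -B'E; apply: Bw.
    by rewrite /= !inE mem_tnth.
  move=> Bw j /=; rewrite !inE => /tnthP[i ->]; rewrite B'E.
  by have := Bw i; rewrite tnth_mktuple.
rewrite /distribution /pushforward => ->; last 2 first.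
- by move=> j; rewrite !inE; move/allP: l0; apply.
- by move=> j; rewrite !inE => /tnthP[i ->]; rewrite B'E.
rewrite (perm_big (l : seq nat)); last first.
  apply: uniq_perm => //; first exact: fset_uniq.
  by move=> j; rewrite !inE.
rewrite big_tuple; apply: eq_bigr => i _; rewrite B'E.
by apply: idX => //; move/allP: l0; apply; exact: mem_tnth.
Qed.

(** Both laws give a box the product of the masses of its sides under the law of [X 1], and boxes
    form a generating pi-system. *)
Lemma subsample_exchangeable k (l l' : k.-tuple nat) (A : set (k.-tuple R)) :
  uniq l -> uniq l' -> all (leq 1) l -> all (leq 1) l' -> measurable A ->
  P (subsample l @^-1` A) = P (subsample l' @^-1` A).
Proof.
move=> ul ul' l0 l'0 mA.
apply: (measure_unique _ (fun=> setT) (@measurable_tupleE _ R k) _ _ _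
  (distribution P (subsample l)) (distribution P (subsample l'))) => //.
- move=> _ _ [B mB <-] [C mC <-]; exists (fun i => B i `&` C i).
    by move=> i; exact: measurableI.
  apply/seteqP; split=> x /=; first by move=> BC; split=> i; case: (BC i).
  by move=> [Bx Cx] i; split.
- move=> _; exists (fun=> setT) => //.
  by apply/seteqP; split.
- by apply/seteqP; split=> // x _; exists 0%N.
- move=> _ [B mB <-].
  exact: etrans (subsample_box ul l0 mB) (esym (subsample_box ul' l'0 mB)).
- move=> i; apply: le_lt_trans (ltry 1).
  exact: (probability_le1 (distribution P (subsample l))).
Qed.

(** An atom at [x] would keep the distribution function below its value at [x] by the mass of the
    atom all along x - 1/(k+1), against continuity. *)
Lemma distribution_set1 t x : (0 < t)%N -> distribution P (X t) [set x] = 0%E.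
Proof.
move=> t0; set mu := distribution P (X t).
have cdf_lt y : y < x -> (cdf (X t) y <= cdf (X t) x - mu [set x])%E.
  move=> yx; rewrite leeBrDr ?fin_num_measure//.
  rewrite /cdf -/mu -measureU//.
    apply: le_measure; rewrite ?inE//; first exact: measurableU.
    move=> z [|->] /=; rewrite !in_itv/=; last exact: lexx.
    by move=> /le_trans; apply; exact: ltW.
  apply/seteqP; split=> // z [] /=; rewrite in_itv/= => + zx.
  by rewrite zx leNgt yx.
have : (cdf (X t) (x - k.+1%:R^-1) @[k --> \oo] --> cdf (X t) x)%E.
  apply: continuous_cvg; first exact: ctsX.
  rewrite -[X in _ --> X]subr0; apply: cvgB; first exact: cvg_cst.
  exact: cvg_harmonic.
move=> cv; apply/eqP; rewrite eq_le measure_ge0 andbT.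
have : (cdf (X t) x <= cdf (X t) x - mu [set x])%E.
  rewrite -{1}(cvg_lim _ cv)//; apply: lime_le.
    by apply/cvg_ex; eexists; exact: cv.
  by apply: nearW => k; apply: cdf_lt; rewrite gtrBl invr_gt0.
by rewrite leeBrDr ?fin_num_measure// -[leRHS]adde0 leeD2lE// fin_num_measure.
Qed.

(** By independence the joint law is a product, and by Fubini the diagonal is null because its
    sections are single points. *)
Lemma no_tie i j : (0 < i)%N -> (0 < j)%N -> i != j ->
  P [set w | X i w = X j w] = 0%E.
Proof.
move=> i0 j0 ij.
pose Z w := (X i w, X j w).
have mZ : measurable_fun setT Z.
  by apply: measurable_fun_pair; exact: measurable_funPT.
pose Zf : {mfun T >-> (R * R)%type} :=
  HB.pack Z (isMeasurableFun.Build _ _ _ _ Z mZ).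
pose D : set (R * R) := [set x | x.1 = x.2].
have mD : measurable D.
  rewrite (_ : D = [set: R * R] `&` (fun x => x.1 == x.2) @^-1` [set true]).
    exact: (measurable_fun_eqr measurable_fst measurable_snd).
  apply/seteqP; split=> x; rewrite /D/=; first by move=> ->; rewrite eqxx.
  by move=> [_ /eqP].
have joint A B : measurable A -> measurable B ->
    distribution P Zf (A `*` B) =
    (distribution P (X i) A * distribution P (X j) B)%E.
  move=> mA mB.
  have := @indX [fset i; j]%fset (fun k => if k == i then A else B) _ _.
  rewrite big_fsetU1 ?inE//= big_seq_fset1 eqxx eq_sym (negbTE ij) => <-.
  - congr (P _); apply/seteqP; split=> w.
      move=> [/= Aw Bw] k /=; rewrite !inE => /orP[]/eqP->; rewrite ?eqxx//.
      by rewrite eq_sym (negbTE ij).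
    move=> /= H; split=> /=.
      by have := H i; rewrite /= !inE !eqxx/=; exact.
    by have := H j; rewrite /= !inE !eqxx orbT eq_sym (negbTE ij)/=; exact.
  - by move=> k; rewrite !inE => /orP[]/eqP->.
  - move=> k; rewrite !inE => /orP[]/eqP->; rewrite ?eqxx//.
    by rewrite eq_sym (negbTE ij).
rewrite (_ : P _ = distribution P Zf D)//.
rewrite -(product_measure_unique joint mD) /product_measure1 /=.
apply: integral0_eq => x _ /=.
rewrite (_ : xsection D x = [set x]); first exact: distribution_set1.
by apply/seteqP; split=> y; rewrite /xsection/= inE /D/= => ->.
Qed.

End iid.

(** * Rank sequences and orders *)

Definition insert_at (T : Type) k (x : T) (v : seq T) : seq T :=
  take k v ++ x :: drop k v.

Lemma map_insert_at (T U : Type) (f : T -> U) k x v :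
  map f (insert_at k x v) = insert_at k (f x) (map f v).
Proof. by rewrite /insert_at map_cat /= map_take map_drop. Qed.

Lemma perm_insert_at (T : eqType) k (x : T) v :
  perm_eq (insert_at k x v) (x :: v).
Proof.
by rewrite /insert_at perm_catC /= perm_cons perm_catC cat_take_drop.
Qed.

(** When [v] is decreasing, having exactly [k] entries above [x] means that these are the first [k],
    which is what the insertion needs. *)
Lemma sorted_insert_at (R : realDomainType) k (x : R) (v : seq R) :
  (k <= size v)%N -> x \notin v ->
  sorted >%R (insert_at k x v) =
  sorted >%R v && (count (>= x) v == k).
Proof.
move=> kv xv.
have tr : transitive (>%R : rel R).
  by move=> a b c /= ba cb; exact: lt_trans cb ba.
rewrite !(sorted_pairwise tr) /insert_at pairwise_cat /= allrel_consr.
have ne y : y \in v -> (x == y) = false.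
  by move=> yv; apply/negbTE; apply: contraNneq xv => ->.
rewrite -[in RHS](cat_take_drop k v) pairwise_cat count_cat.
have neT y : y \in take k v -> (x == y) = false by move/mem_take; exact: ne.
have neD y : y \in drop k v -> (x == y) = false by move/mem_drop; exact: ne.
have sT : size (take k v) = k by rewrite size_take_min; apply/minn_idPl.
move: (take k v) (drop k v) neT neD sT => u1 u2 ne1 ne2 s1.
have -> : all (>%R ^~ x) u1 = (count (>= x) u1 == k).
  rewrite -s1 -all_count; apply: eq_in_all => y yu /=.
  by rewrite le_eqVlt ne1.
have -> : all (>%R x) u2 = (count (>= x) u2 == 0%N).
  rewrite eqn0Ngt -has_count -all_predC; apply: eq_in_all => y yu /=.
  by rewrite ltNge.
case: allrelP => r12; rewrite ?andbF//= andbT.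
case: (pairwise _ u1); rewrite ?andbF//=.
case p2: (pairwise _ u2); rewrite ?andbF//= ?andbT.
have c1 : (count (>= x) u1 <= k)%N by rewrite -s1 count_size.
have [/eqP->|c2] := boolP (count _ u2 == 0%N); first by rewrite addn0 andbT.
rewrite andbF; apply/esym/negbTE.
(* An entry [z] of the tail above [x] puts the whole head above [x] too, so the total count exceeds
   [k]. *)
have /hasP[z zu2 xz] : has (>= x) u2 by rewrite has_count lt0n.
have -> : count (>= x) u1 = k.
  rewrite -s1; apply/eqP; rewrite -all_count; apply/allP => y yu1.
  exact: le_trans xz (ltW (r12 _ _ yu1 zu2)).
by rewrite -{2}[k]addn0 eqn_add2l.
Qed.

Lemma iota_rcons m n : iota m n.+1 = rcons (iota m n) (m + n)%N.
Proof. by rewrite -addn1 iotaD cats1. Qed.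

(* [rank_order s] lists 1, ..., size s by decreasing value of the observations
   when [s] is the sequence of their relative ranks. *)
Definition rank_order (s : seq nat) : seq nat :=
  foldl (fun l r => insert_at r.-1 (size l).+1 l) [::] s.

(** These are the possible sequences of relative ranks; index [i] belongs to observation [i.+1]. *)
Definition rank_seq (s : seq nat) : bool :=
  all (fun i => 0 < nth 0 s i <= i.+1)%N (iota 0 (size s)).

Lemma rank_seq_rcons s r :
  rank_seq (rcons s r) = rank_seq s && (0 < r <= (size s).+1)%N.
Proof.
rewrite /rank_seq size_rcons iota_rcons add0n all_rcons nth_rcons ltnn eqxx.
rewrite andbC.
congr andb; apply: eq_in_all => i; rewrite mem_iota add0n => /= i_s.
by rewrite nth_rcons i_s.
Qed.

Lemma rank_order_rcons s r :
  rank_order (rcons s r) =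
  insert_at r.-1 (size (rank_order s)).+1 (rank_order s).
Proof. by rewrite /rank_order -cats1 foldl_cat. Qed.

Lemma size_rank_order s : size (rank_order s) = size s.
Proof.
elim/last_ind: s => // s r ih; rewrite rank_order_rcons.
by rewrite (perm_size (perm_insert_at _ _ _)) /= ih size_rcons.
Qed.

Lemma perm_rank_order s : perm_eq (rank_order s) (iota 1 (size s)).
Proof.
elim/last_ind: s => // s r ih; rewrite rank_order_rcons.
apply: perm_trans (perm_insert_at _ _ _) _.
rewrite size_rank_order size_rcons iota_rcons add1n.
by rewrite perm_sym perm_rcons perm_cons perm_sym.
Qed.

(** * Ranks as counts, and the tree of rank cylinders *)

Section ranks.
Context d (T : measurableType d) (R : realType) (P : probability T R).
Variable X : nat -> {RV P >-> R}.

Definition untied (w : T) :=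
  forall i j, (0 < i)%N -> (0 < j)%N -> X i w = X j w -> i = j.

Lemma absolute_rankE n t w :
  absolute_rank X n t w = count (fun j => X t w <= X j w) (iota 1 n).
Proof.
rewrite -sum1_count big_mkcond /absolute_rank /index_iota subSS subn0.
by apply: eq_bigr => j _; case: (_ <= _).
Qed.

Lemma absolute_rankS n t w :
  absolute_rank X n.+1 t w = (absolute_rank X n t w + (X t w <= X n.+1 w)%R)%N.
Proof. by rewrite !absolute_rankE iota_rcons -cats1 count_cat /= addn0. Qed.

Lemma relative_rankS n w :
  relative_rank X n.+1 w = (absolute_rank X n n.+1 w).+1.
Proof. by rewrite [LHS]absolute_rankS lexx addn1. Qed.

Lemma absolute_rank_le n t w : (absolute_rank X n t w <= n)%N.
Proof. by rewrite absolute_rankE -[leqRHS](size_iota 1); exact: count_size. Qed.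

Lemma relative_rank_bound t w : (0 < t)%N -> (0 < relative_rank X t w <= t)%N.
Proof.
by case: t => // t _; rewrite relative_rankS /= ltnS absolute_rank_le.
Qed.

(** Without ties, $X_t<X_{n+1}$ exactly when fewer of the first [n] observations reach $X_{n+1}$
    than reach $X_t$, that is when $R_{n+1}\le A_{t,n}$. So the new relative rank alone updates the
    absolute rank. *)
Lemma untied_absolute_rankS n t w : untied w -> (0 < t <= n)%N ->
  absolute_rank X n.+1 t w =
  (absolute_rank X n t w + (relative_rank X n.+1 w <= absolute_rank X n t w))%N.
Proof.
move=> unt /andP[t0 tn]; rewrite absolute_rankS; congr (_ + nat_of_bool _)%N.
rewrite relative_rankS !absolute_rankE; have [le|lt] := leP (X t w) (X n.+1 w).
  have tl : t \in iota 1 n by rewrite mem_iota t0 add1n ltnS.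
  have lt : X t w < X n.+1 w.
    rewrite lt_neqAle le andbT; apply/eqP => /unt e.
    by move: tn; rewrite e// ltnn.
  apply/esym.
  (* Observation [t] reaches $X_t$ but not $X_{n+1}$, which makes the inequality between the counts
     strict. *)
  have := count_predUI (fun j => X n.+1 w <= X j w) (pred1 t) (iota 1 n).
  rewrite (count_uniq_mem _ (iota_uniq 1 n)) tl.
  rewrite (@eq_count _ (predI _ _) pred0); last first.
    by move=> j /=; case: eqP => [->|]; rewrite ?andbF// leNgt lt.
  rewrite count_pred0 addn0 addn1 => <-.
  apply: sub_count => j /= /orP[|/eqP->//].
  by apply: le_trans; exact: ltW.
apply/esym/negbTE; rewrite -ltnNge ltnS; apply: sub_count => j /= tj.
exact: le_trans (ltW lt) tj.
Qed.

Definition rank_prefix t w : seq nat :=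
  [seq relative_rank X i w | i <- iota 1 t].

Lemma rank_prefixS t w :
  rank_prefix t.+1 w = rcons (rank_prefix t w) (relative_rank X t.+1 w).
Proof. by rewrite /rank_prefix iota_rcons map_rcons. Qed.

Definition cylinder (s : seq nat) : set T :=
  [set w | rank_prefix (size s) w = s].

Lemma cylinder_nil : cylinder [::] = setT.
Proof. by apply/seteqP; split. Qed.

Lemma cylinder_rcons s r :
  cylinder (rcons s r) =
  cylinder s `&` [set w | relative_rank X (size s).+1 w = r].
Proof.
apply/seteqP; split=> w; rewrite /cylinder /= size_rcons rank_prefixS.
  by move/eqP; rewrite eqseq_rcons => /andP[/eqP -> /eqP ->].
by move=> [-> ->].
Qed.

Definition decreasing_along (l : seq nat) : set T :=
  [set w | sorted >%R [seq X i w | i <- l]].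

(** The last observation fits at position [r.-1] exactly when [r.-1] earlier ones lie above it. This
    turns an event on ranks into one on the order, to which exchangeability applies. *)
Lemma cylinder_decreasing s w : rank_seq s -> untied w ->
  cylinder s w <-> decreasing_along (rank_order s) w.
Proof.
move=> + unt; elim/last_ind: s => [|s r ih]; first by rewrite cylinder_nil.
rewrite rank_seq_rcons => /andP[/ih{}ih /andP[r0 rs]].
rewrite cylinder_rcons rank_order_rcons /decreasing_along /= map_insert_at.
rewrite size_rank_order sorted_insert_at; last 2 first.
- by rewrite size_map size_rank_order; case: r r0 rs.
- apply/mapP => -[j]; rewrite (perm_mem (perm_rank_order s)) mem_iota.
  by move=> /andP[j0 js] /unt e; move: js; rewrite -e// add1n ltnn.
rewrite relative_rankS count_map (permP (perm_rank_order s)) absolute_rankE.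
split=> [[/ih + rE]|/andP[/ih + /eqP rE]].
  by rewrite /decreasing_along /= => ->; rewrite -rE eqxx.
by split=> //; rewrite -[r]prednK//; congr _.+1.
Qed.

End ranks.

(** * The law of the relative ranks *)

Lemma measure_eq_mod_negligible d (T : measurableType d) (R : realFieldType)
    (mu : {measure set T -> \bar R}) (A B N : set T) :
  measurable A -> measurable B -> mu.-negligible N ->
  (forall x, ~ N x -> A x <-> B x) -> mu A = mu B.
Proof.
move=> mA mB [M [mM M0 NM]] AB.
have le C D : measurable C -> measurable D ->
    (forall x, ~ N x -> C x -> D x) -> (mu C <= mu D)%E.
  move=> mC mD CD; rewrite -(measureU0 mD mM M0).
  apply: le_measure; rewrite ?inE//; first exact: measurableU.
  move=> x Cx; have [/NM Mx|Nx] := pselect (N x); first by right.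
  by left; exact: CD.
by apply/eqP; rewrite eq_le !le// => x /AB[].
Qed.

Lemma measurable_sorted_tuple (R : realType) k :
  measurable [set x : k.-tuple R | sorted >%R x].
Proof.
rewrite (_ : mkset _ = \bigcap_(i : nat)
    [set x : k.-tuple R | (i.+1 < k)%N ==> (x`_i.+1 < x`_i)]); last first.
  apply/seteqP; split=> x /=.
    move=> /(sortedP 0) sx i _ /=; apply/implyP => ik.
    by apply: sx; rewrite size_tuple.
  move=> sx; apply/(sortedP 0) => i; rewrite size_tuple => ik.
  by have /implyP := sx i I; exact.
apply: bigcapT_measurable => i.
have [ik|] /= := boolP (i.+1 < k)%N; last first.
  by rewrite (_ : mkset _ = setT)//; apply/seteqP; split.
have mnth j (jk : (j < k)%N) : measurable_fun setT (fun x : k.-tuple R => x`_j).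
  rewrite (_ : (fun _ => _) = (@tnth k R ^~ (Ordinal jk))).
    exact: measurable_tnth.
  by apply/funext => x; rewrite (tnth_nth 0).
have := measurable_fun_ltr (mnth _ ik) (mnth _ (ltnW ik)).
by move=> /(_ measurableT [set true]); rewrite setTI; exact.
Qed.

Section rank_law.
Context d (T : measurableType d) (R : realType) (P : probability T R).
Variable X : nat -> {RV P >-> R}.

Lemma measurable_RV_le i j : measurable [set w | X i w <= X j w].
Proof.
have := measurable_fun_ler (@measurable_funPT _ _ _ _ (X i))
  (@measurable_funPT _ _ _ _ (X j)).
by move=> /(_ measurableT [set true]); rewrite setTI; exact.
Qed.

Lemma measurable_absolute_rank n t b :
  measurable [set w | absolute_rank X n t w = b].
Proof.
elim: n b => [|n ih] b.
  under eq_fun do rewrite absolute_rankE/=.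
  have [->|b0] := eqVneq b 0%N.
    by rewrite (_ : mkset _ = setT)//; apply/seteqP; split.
  rewrite (_ : mkset _ = set0)//; apply/seteqP; split => // w /= e.
  by rewrite -e eqxx in b0.
rewrite (_ : mkset _ =
  ([set w | absolute_rank X n t w = b] `\` [set w | X t w <= X n.+1 w]) `|`
  ([set w | (0 < b)%N] `&` [set w | absolute_rank X n t w = b.-1] `&`
   [set w | X t w <= X n.+1 w])).
  apply: measurableU.
    by apply: measurableD => //; exact: measurable_RV_le.
  apply: measurableI; last exact: measurable_RV_le.
  apply: measurableI => //.
  by case: b => [|b]; [rewrite (_ : mkset _ = set0)|rewrite (_ : mkset _ = setT)]
    => //; apply/seteqP; split.
apply/seteqP; split=> w /=; rewrite absolute_rankS.
  have [_ <-|_ <-] := boolP (X t w <= X n.+1 w); first by right; rewrite addn1.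
  by left; rewrite addn0; split.
by move=> [[-> /negP/negbTE ->]|[[b0 ->] ->]]; rewrite ?addn0// addn1 prednK.
Qed.

Lemma measurable_cylinder s : measurable (cylinder X s).
Proof.
elim/last_ind: s => [|s r ih]; first by rewrite cylinder_nil.
rewrite cylinder_rcons.
by apply: measurableI => //; exact: measurable_absolute_rank.
Qed.

Lemma Rintegral_cylinder (f : T -> R) s : P.-integrable setT (EFin \o f) ->
  \int[P]_(w in cylinder X s) f w =
  \sum_(1 <= r < (size s).+2) \int[P]_(w in cylinder X (rcons s r)) f w.
Proof.
move=> intf.
(* The children are added one at a time, by induction on a bound [k] for the next rank: the event is
   empty at 0, since ranks are positive, and full at [(size s).+1]. *)
pose Rle k := [set w | (relative_rank X (size s).+1 w <= k)%N].
have -> : cylinder X s = cylinder X s `&` Rle (size s).+1.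
  rewrite setIidl// => w _; rewrite /Rle /=.
  by have /andP[] := @relative_rank_bound _ _ _ P X (size s).+1 w isT.
have RleS k :
    Rle k.+1 = Rle k `|` [set w | relative_rank X (size s).+1 w = k.+1].
  apply/seteqP; split=> w; rewrite /Rle /=.
    by rewrite leq_eqVlt ltnS => /orP[/eqP|]; [right|left].
  by move=> [/leqW|->].
have mR k : measurable (Rle k).
  elim: k => [|k ih].
    rewrite (_ : Rle 0%N = [set w | relative_rank X (size s).+1 w = 0%N]).
      exact: measurable_absolute_rank.
    by apply/seteqP; split=> w; rewrite /Rle/= leqn0 => /eqP.
  by rewrite RleS; apply: measurableU => //; exact: measurable_absolute_rank.
elim: (size s).+1 => [|k ih].
  rewrite big_geq// (_ : Rle 0%N = set0) ?setI0 ?Rintegral_set0//.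
  apply/seteqP; split=> // w; rewrite /Rle /= leqn0 => /eqP e.
  have /andP[] := @relative_rank_bound _ _ _ P X (size s).+1 w isT.
  by rewrite e.
rewrite big_nat_recr//= -ih RleS setIUr -cylinder_rcons Rintegral_setU//.
- by apply: measurableI => //; exact: measurable_cylinder.
- exact: measurable_cylinder.
- apply: integrableS intf => //.
  apply: measurableU; last exact: measurable_cylinder.
  by apply: measurableI => //; exact: measurable_cylinder.
- rewrite disj_set2E; apply/eqP/seteqP; split=> // w.
  by rewrite cylinder_rcons /Rle /= => -[[_ +] [_ e]]; rewrite e ltnn.
Qed.

Hypothesis indX : independent_seq X.
Hypothesis idX : identically_distributed X.
Hypothesis ctsX : forall t, (0 < t)%N -> continuous (cdf (X t)).

Lemma negligible_ties : P.-negligible (~` [set w | untied X w]).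
Proof.
pose tie i j := if [&& (0 < i)%N, (0 < j)%N & i != j]
  then [set w | X i w = X j w] else set0.
apply: (@negligibleS _ _ _ _ (\bigcup_i \bigcup_j tie i j)).
  move=> w unt; apply: contrapT => tw; apply: unt => i j i0 j0 e.
  apply: contrapT => /eqP ij; apply: tw; exists i => //; exists j => //.
  by rewrite /tie i0 j0 ij.
apply: negligible_bigcup => i; apply: negligible_bigcup => j; rewrite /tie.
case: ifPn => [/and3P[i0 j0 ij]|_]; last exact: negligible_set0.
apply/negligibleP; last exact: no_tie.
rewrite (_ : mkset _ = [set w | X i w <= X j w] `&` [set w | X j w <= X i w]).
  by apply: measurableI; exact: measurable_RV_le.
apply/seteqP; split=> w /=; first by move=> ->.
by move=> [a b]; apply/eqP; rewrite eq_le a b.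
Qed.

Lemma decreasing_along_subsample k (l : k.-tuple nat) :
  decreasing_along X l = subsample X l @^-1` [set x | sorted >%R x].
Proof.
suff E w : [seq X i w | i <- l] = subsample X l w.
  by apply/seteqP; split=> w; rewrite /decreasing_along /= E.
by rewrite -[in LHS](map_tnth_enum l) -map_comp.
Qed.

Lemma measurable_decreasing_along l : measurable (decreasing_along X l).
Proof.
rewrite -[l]/(tval (in_tuple l)) decreasing_along_subsample -[_ @^-1` _]setTI.
by apply: measurable_subsample => //; exact: measurable_sorted_tuple.
Qed.

(** Up to ties, each cylinder says that the observations decrease along a list of distinct positive
    indices, and lists of equal length are exchangeable. *)
Lemma cylinder_prob s s' : rank_seq s -> rank_seq s' -> size s = size s' ->
  P (cylinder X s) = P (cylinder X s').
Proof.
move=> vs vs' ss'.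
have E u : rank_seq u ->
    P (cylinder X u) = P (decreasing_along X (rank_order u)).
  move=> vu; apply: measure_eq_mod_negligible negligible_ties _.
  - exact: measurable_cylinder.
  - exact: measurable_decreasing_along.
  by move=> w /contrapT; exact: cylinder_decreasing.
have ok u : uniq (rank_order u) && all (leq 1) (rank_order u).
  have := perm_rank_order u => pu.
  rewrite (perm_uniq pu) iota_uniq (perm_all _ pu) /=.
  by apply/allP => i; rewrite mem_iota => /andP[].
have /andP[u1 a1] := ok s; have /andP[u2 a2] := ok s'.
rewrite !E//.
have ss : size (rank_order s') == size (rank_order s).
  by rewrite !size_rank_order ss'.
pose t1 := in_tuple (rank_order s); pose t2 := Tuple ss.
rewrite -[rank_order s]/(tval t1) -[rank_order s']/(tval t2).
rewrite !decreasing_along_subsample.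
by apply: subsample_exchangeable => //; exact: measurable_sorted_tuple.
Qed.

(** The [(size s).+1] children are equally likely; their probabilities are summed by integrating the
    constant 1. *)
Lemma cylinder_prob_rcons s r : rank_seq (rcons s r) ->
  fine (P (cylinder X s)) = (size s).+1%:R * fine (P (cylinder X (rcons s r))).
Proof.
move=> vs; have := vs; rewrite rank_seq_rcons => /andP[vs0 rb].
have int1 : P.-integrable setT (EFin \o (fun=> 1 : R)).
  exact: finite_measure_integrable_cst.
have := Rintegral_cylinder s int1.
rewrite Rintegral_cst; last exact: measurable_cylinder.
rewrite mul1r => ->.
rewrite big_nat (eq_bigr (fun=> fine (P (cylinder X (rcons s r))))); last first.
  move=> r' r'b; rewrite Rintegral_cst; last exact: measurable_cylinder.
  rewrite mul1r; congr fine; apply: cylinder_prob => //; last first.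
    by rewrite !size_rcons.
  by rewrite rank_seq_rcons vs0.
by rewrite -big_nat sumr_const_nat subSS subn0 mulr_natl.
Qed.

End rank_law.

(** * The backward recursion for the reward *)

Section rank_reward.
Variables (R : realType) (q : nat -> R) (n : nat).

(** The added terms vanish: the first binomial coefficient for $a<r$, the second for $a>n-t+r$. A
    range free of [t] and [r] lets the recursion be proved term by term. *)
Lemma rank_rewardE t r : (0 < r <= t)%N -> (t <= n)%N ->
  rank_reward q n t r =
  \sum_(1 <= a < n.+1) q a *
    (('C(a - 1, r - 1) * 'C(n - a, t - r))%N%:R / 'C(n, t)%:R).
Proof.
move=> /andP[r0 rt] tn; rewrite /rank_reward.
rewrite [RHS](@big_cat_nat _ _ _ r)//=; last by lia.
rewrite [X in _ = X + _]big_nat [X in _ = X + _]big1 ?add0r; last first.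
  move=> a /andP[a0 ar].
  by rewrite ['C(a - 1, _)]bin_small ?mul0n ?mul0r ?mulr0//; lia.
rewrite [RHS](@big_cat_nat _ _ _ (n - t + r).+1)//=; [|lia|lia].
rewrite [X in _ + X]big_nat [X in _ + X]big1 ?addr0// => a /andP[ta an].
by rewrite ['C(n - a, _)]bin_small ?muln0 ?mul0r ?mulr0//; lia.
Qed.

Lemma rank_reward_final r : (0 < r <= n)%N -> rank_reward q n n r = q r.
Proof.
move=> /andP[r0 rn]; rewrite /rank_reward subnn add0n big_nat1.
by rewrite !binn muln1 divr1 mulr1.
Qed.

(* With [b] the absolute rank among the first [t] observations, the next one
   falls above it with probability [b / (t + 1)]. *)
Lemma rank_reward_rec t b : (0 < b <= t)%N -> (t < n)%N ->
  t.+1%:R * rank_reward q n t b =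
  b%:R * rank_reward q n t.+1 b.+1 + (t.+1 - b)%:R * rank_reward q n t.+1 b.
Proof.
move=> /andP[b0 bt] tn.
rewrite !rank_rewardE ?b0 ?bt ?ltnS//; [|lia|lia].
rewrite !mulr_sumr -big_split/=; apply: eq_big_nat => a /andP[a0 an].
rewrite !subn1 /= subSS.
have Cn : 'C(n, t)%:R != 0 :> R by rewrite pnatr_eq0 -lt0n bin_gt0 ltnW.
have Cn1 : 'C(n, t.+1)%:R != 0 :> R by rewrite pnatr_eq0 -lt0n bin_gt0.
(* [e1] and [e2] bring both weights of time $t+1$ to the common product
   $\binom{a-1}{b-1}\binom{n-a}{t-b}$, with factors that add up to $n-t$. *)
have e1 : (b * 'C(a.-1, b) = (a - b) * 'C(a.-1, b.-1))%N.
  case: b b0 bt => // b _ _; case: a a0 an => // a _ _ /=.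
  by rewrite mul_bin_left subSS.
have e2 : ((t.+1 - b) * 'C(n - a, t.+1 - b) =
    (n - a - (t - b)) * 'C(n - a, t - b))%N.
  by rewrite subSn// mul_bin_left.
have e3 : (t.+1 * 'C(n, t.+1) = (n - t) * 'C(n, t))%N by rewrite mul_bin_left.
have key : (b * ('C(a.-1, b) * 'C(n - a, t - b)) +
    (t.+1 - b) * ('C(a.-1, b.-1) * 'C(n - a, t.+1 - b)) =
    (n - t) * ('C(a.-1, b.-1) * 'C(n - a, t - b)))%N.
  rewrite mulnA e1 [X in (_ + _ * X)%N]mulnC mulnA e2.
  (* Truncated subtraction can spoil the sum of the factors only where the common product is
     zero. *)
  have [ab|ba] := ltnP a b.
    by rewrite ['C(a.-1, b.-1)]bin_small ?muln0 ?mul0n ?muln0//; lia.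
  have [nat|nat] := ltnP (n - a) (t - b).
    by rewrite ['C(n - a, t - b)]bin_small ?muln0//.
  have -> : (n - t = (a - b) + (n - a - (t - b)))%N by lia.
  lia.
have keyR : b%:R * ('C(a.-1, b) * 'C(n - a, t - b))%:R +
    (t.+1 - b)%:R * ('C(a.-1, b.-1) * 'C(n - a, t.+1 - b))%:R =
    (n - t)%:R * ('C(a.-1, b.-1) * 'C(n - a, t - b))%:R :> R.
  by rewrite -!natrM -natrD key.
have e3R : t.+1%:R / 'C(n, t)%:R = (n - t)%:R / 'C(n, t.+1)%:R :> R.
  by apply/eqP; rewrite eqr_div// -!natrM e3.
transitivity (q a * ((n - t)%:R / 'C(n, t.+1)%:R) *
    ('C(a.-1, b.-1) * 'C(n - a, t - b))%:R).
  by rewrite -e3R; ring.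
rewrite [LHS]mulrAC -mulrA [X in q a * X = _]mulrA.
by rewrite [X in q a * (X / _) = _]mulrC -keyR; ring.
Qed.

End rank_reward.

(** * Optimal stopping *)

Lemma measurable_fun_countable_choice d d' (T : measurableType d)
    (U : measurableType d') (z : T -> nat) (F : nat -> T -> U) :
  (forall k, measurable [set w | z w = k]) ->
  (forall k, measurable_fun setT (F k)) ->
  measurable_fun setT (fun w => F (z w) w).
Proof.
move=> mz mF _ B mB; rewrite setTI.
rewrite (_ : _ @^-1` B = \bigcup_k ([set w | z w = k] `&` F k @^-1` B)).
  apply: bigcup_measurable => k _; apply: measurableI => //.
  by rewrite -[_ @^-1` B]setTI; exact: mF.
by apply/seteqP; split=> w /= => [Bw|[k _ [<-]]//]; exists (z w).
Qed.

(** Serves [reward], [gain] and the final reward of a fixed observation alike. Only finitely many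
    values occur, so the sum of their absolute values is a bound. *)
Lemma integrable_stopped d (T : measurableType d) (R : realType)
    (P : probability T R) n (h : nat -> nat -> R) (tau : T -> nat)
    (B : nat -> T -> nat) :
  (forall w, (tau w <= n)%N) -> (forall t w, (t <= n)%N -> (B t w <= n)%N) ->
  (forall t, measurable [set w | tau w = t]) ->
  (forall t b, measurable [set w | B t w = b]) ->
  P.-integrable setT (EFin \o (fun w => h (tau w) (B (tau w) w))).
Proof.
move=> taun Bn mtau mB.
apply: measurable_bounded_integrable => //.
- by rewrite ltey_eq fin_num_measure.
- apply: (@measurable_fun_countable_choice _ _ T R tau
    (fun t w => h t (B t w))) => // t.
  exact: (@measurable_fun_countable_choice _ _ T R (B t) (fun b _ => h t b)).
- exists (\sum_(t < n.+1) \sum_(b < n.+1) `|h t b|).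
  split=> [|M ltM w _ /=]; first exact: num_real.
  apply: le_trans (ltW ltM).
  have tn := taun w; have bn := Bn _ w tn.
  rewrite (bigD1 (Ordinal (tn : (tau w < n.+1)%N)))//=.
  rewrite (bigD1 (Ordinal (bn : (B (tau w) w < n.+1)%N)))//=.
  rewrite -addrA lerDl addr_ge0// ?sumr_ge0// => i _; exact: sumr_ge0.
Qed.

Lemma natural_filtration_measurable d (T : measurableType d) d'
    (E : measurableType d') (Z : nat -> T -> E) t A :
  (forall s, (0 < s)%N -> measurable_fun setT (Z s)) ->
  natural_filtration Z t A -> measurable A.
Proof.
move=> mZ; apply: smallest_sub; first exact: sigma_algebra_measurable.
by move=> _ [s /andP[s0 _]] [B mB <-]; exact: mZ.
Qed.

(** The sets that do not separate [w] from [w'] form a sigma-algebra containing the generators. For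
    stopping times: outcomes with the same first [t] ranks make the same decision at time [t]. *)
Lemma natural_filtration_saturated (T : pointedType) d' (E : measurableType d')
    (Z : nat -> T -> E) t A w w' : natural_filtration Z t A ->
  (forall s, (0 < s <= t)%N -> Z s w = Z s w') -> A w -> A w'.
Proof.
move=> ZA ZZ.
suff : natural_filtration Z t `<=` [set A | A w <-> A w'] by move=> /(_ A ZA)[].
apply: smallest_sub.
- split=> /=.
  + by [].
  + by move=> B /= BB; split=> -[_ nB]; split=> // /BB.
  + by move=> F FF; split=> -[k _ /FF]; exists k.
- move=> _ [s s_t] [B mB <-].
  by split=> -[_ Bw]; split=> //; move: Bw; rewrite /= ZZ.
Qed.

Section optimal_stopping.
Context d (T : measurableType d) (R : realType) (P : probability T R).
Variables (n : nat) (q : nat -> R) (X : nat -> {RV P >-> R}).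
Hypothesis indX : independent_seq X.
Hypothesis idX : identically_distributed X.
Hypothesis ctsX : forall t, (0 < t)%N -> continuous (cdf (X t)).

Let p s := fine (P (cylinder X s)).
Let g := rank_reward q n.
Let reward tau w := g (tau w) (relative_rank X (tau w) w).
Let gain tau w := q (absolute_rank X n (tau w) w).
Let TR := stopping_times n (natural_filtration (relative_rank X)).
Let TY := stopping_times n
  (natural_filtration (fun t w => g t (relative_rank X t w))).

Let p_rcons s r : rank_seq (rcons s r) -> p s = (size s).+1%:R * p (rcons s r).
Proof. exact: cylinder_prob_rcons. Qed.

Let p_ge0 s : 0 <= p s. Proof. exact/fine_ge0/measure_ge0. Qed.

(** The root has probability 1 and each child a positive fraction of its parent's probability, so no
    admissible cylinder is null. *)
Lemma cylinder_nonempty s : rank_seq s -> exists w, cylinder X s w.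
Proof.
move=> vs; apply/set0P/eqP => c0.
suff : p s != 0 by rewrite /p c0 measure0 eqxx.
elim/last_ind: s vs {c0} => [_|s r ih vs].
  by rewrite /p cylinder_nil probability_setT oner_neq0.
have /ih : rank_seq s by move: vs; rewrite rank_seq_rcons => /andP[].
by rewrite (p_rcons vs) mulf_eq0 negb_or => /andP[].
Qed.

Lemma cylinder_rank s i w : cylinder X s w -> (0 < i <= size s)%N ->
  relative_rank X i w = nth 0%N s i.-1.
Proof.
move=> sw /andP[i0 i_s]; rewrite -[in RHS]sw /rank_prefix.
by rewrite (nth_map 0%N) ?size_iota ?nth_iota ?prednK// add1n prednK.
Qed.

Lemma stopping_time_measurable tau : TR tau ->
  forall t, measurable [set w | tau w = t].
Proof.
move=> [tn Ft] t; have [tb|tb] := boolP (0 < t <= n)%N.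
  apply: natural_filtration_measurable (Ft t tb) => s s0 _ B mB.
  have := @measurable_fun_countable_choice _ _ T nat (relative_rank X s)
    (fun k w => k) _ _.
  by apply => // k; exact: measurable_absolute_rank.
rewrite (_ : mkset _ = set0)//; apply/seteqP; split=> // w /= e.
by have := tn w; rewrite e (negbTE tb).
Qed.

Lemma integrable_reward tau : TR tau -> P.-integrable setT (EFin \o reward tau).
Proof.
move=> Ttau; apply: (@integrable_stopped _ _ _ _ n) => //.
- by move=> w; have [/(_ w)/andP[]] := Ttau.
- by move=> t w tn; apply: leq_trans tn; exact: absolute_rank_le.
- exact: stopping_time_measurable.
- by move=> t b; exact: measurable_absolute_rank.
Qed.

Lemma integrable_gain tau : TR tau -> P.-integrable setT (EFin \o gain tau).
Proof.
move=> Ttau; apply: (@integrable_stopped _ _ _ _ n (fun=> q)) => //.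
- by move=> w; have [/(_ w)/andP[]] := Ttau.
- by move=> t w tn; exact: absolute_rank_le.
- exact: stopping_time_measurable.
- by move=> t b; exact: measurable_absolute_rank.
Qed.

(** * Expected final reward on a cylinder *)

Lemma integrable_absolute_rank t :
  P.-integrable setT (EFin \o (fun w => q (absolute_rank X n t w))).
Proof.
(* The observation [t] is fixed inside the rank, so the stopping time is a dummy constant 0. *)
apply: (@integrable_stopped _ _ _ _ n (fun=> q) (fun=> 0%N)
  (fun=> absolute_rank X n t)) => //.
- by move=> _ w _; exact: absolute_rank_le.
- move=> k; have [->|k0] := eqVneq 0%N k.
    by rewrite (_ : mkset _ = setT)//; apply/seteqP; split.
  rewrite (_ : mkset _ = set0)//; apply/seteqP; split=> // w /= /eqP.
  by rewrite (negbTE k0).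
- by move=> _ b; exact: measurable_absolute_rank.
Qed.

(** Given the ranks so far, the expected final reward of observation [t] depends only on its current
    absolute rank [b]. Induction on the number [k] of observations to come, with [rank_reward_rec]
    averaging over the children. *)
Lemma Rintegral_absolute_rank k s t b : rank_seq s -> (size s + k)%N = n ->
  (0 < t <= size s)%N -> (0 < b <= size s)%N ->
  (forall w, untied X w -> cylinder X s w ->
     absolute_rank X (size s) t w = b) ->
  \int[P]_(w in cylinder X s) q (absolute_rank X n t w) = g (size s) b * p s.
Proof.
elim: k s b => [|k ih] s b vs sk tb bb Eb.
  move: sk; rewrite addn0 => sn; rewrite sn /g rank_reward_final -?sn//.
  rewrite -Rintegral_cst; last exact: measurable_cylinder.
  congr fine; apply: ae_eq_integral.
  - exact: measurable_cylinder.
  - apply: measurable_funTS.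
    have /integrableP[+ _] := integrable_absolute_rank t.
    by rewrite sn.
  - exact: measurable_cst.
  - apply: (@negligibleS _ _ _ _ (~` [set w | untied X w])).
      by move=> w /= /not_implyP[sw ne] unt; apply: ne; rewrite Eb.
    exact: negligible_ties.
have sn : (size s < n)%N by rewrite -sk -addSnnS leq_addr.
have vr r : (0 < r <= (size s).+1)%N -> rank_seq (rcons s r).
  by rewrite rank_seq_rcons vs.
have step r : (0 < r <= (size s).+1)%N ->
    \int[P]_(w in cylinder X (rcons s r)) q (absolute_rank X n t w) =
    g (size s).+1 (b + (r <= b))%N * p (rcons s r).
  move=> rb; rewrite (ih _ (b + (r <= b))%N); rewrite ?size_rcons//.
  - exact: vr.
  - by rewrite addSnnS.
  - lia.
  - lia.
  - move=> w unt; rewrite cylinder_rcons => -[sw rE].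
    by rewrite untied_absolute_rankS// rE Eb.
rewrite Rintegral_cylinder; last exact: integrable_absolute_rank.
have p1 r : (0 < r <= (size s).+1)%N -> p (rcons s r) = p s / (size s).+1%:R.
  by move=> /vr /p_rcons ->; rewrite mulrC mulKf.
rewrite big_nat (eq_bigr (fun r =>
  g (size s).+1 (b + (r <= b))%N * (p s / (size s).+1%:R))); last first.
  by move=> r rb; rewrite step// p1.
(* The [b] children with [r <= b] raise the absolute rank to [b.+1]; the others leave it at [b]. *)
rewrite -big_nat -mulr_suml (@big_cat_nat _ _ _ b.+1)//=; [|lia].
rewrite big_nat (eq_bigr (fun=> g (size s).+1 b.+1)); last first.
  by move=> r /andP[_ rb]; rewrite -ltnS rb addn1.
rewrite -big_nat sumr_const_nat.
rewrite big_nat (eq_bigr (fun=> g (size s).+1 b)); last first.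
  by move=> r /andP[rb _]; rewrite leqNgt rb addn0.
rewrite -big_nat sumr_const_nat !subSS subn0.
rewrite -[X in X + _]mulr_natl -[X in _ + X]mulr_natl.
rewrite /g -(rank_reward_rec q bb sn).
by field.
Qed.

(* Whether [tau] stops at time [t] depends only on the first [t] ranks, so at a
   child of an undecided node either all outcomes stop or none does. *)
Lemma stopping_induction tau (Phi : seq nat -> Prop) : (0 < n)%N -> TR tau ->
  (forall s, rank_seq s -> (size s < n)%N ->
    (forall r, (0 < r <= (size s).+1)%N ->
       (forall w, cylinder X (rcons s r) w -> tau w = (size s).+1) \/
       [/\ (size s).+1 < n,
           forall w, cylinder X (rcons s r) w -> (size s).+1 < tau w
         & Phi (rcons s r)]%N) ->
    Phi s) ->
  Phi [::].
Proof.
move=> n0 [taub Ftau] step.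
suff H k s : rank_seq s -> (size s + k)%N = n ->
    (forall w, cylinder X s w -> (size s < tau w)%N) -> Phi s.
  by apply: (H n) => // w _; have /andP[] := taub w.
elim: k s => [|k ih] s vs sk und.
  (* At depth [n] an undecided node would contain an outcome with [tau] beyond [n]. *)
  have [w sw] := cylinder_nonempty vs.
  have := und w sw; have /andP[_] := taub w.
  by rewrite -sk addn0 leqNgt => /negbTE ->.
have sn : (size s < n)%N by rewrite -sk -addSnnS leq_addr.
apply: step => // r rb.
have vr : rank_seq (rcons s r) by rewrite rank_seq_rcons vs.
have [[w0 sw0 tw0]|no] := pselect
    (exists2 w, cylinder X (rcons s r) w & tau w = (size s).+1).
  left=> w sw; apply: (natural_filtration_saturated (Ftau (size s).+1 _) _ tw0).
    by rewrite sn.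
  by move=> i ib; rewrite (cylinder_rank sw) ?(cylinder_rank sw0) ?size_rcons.
right.
have und' w : cylinder X (rcons s r) w -> ((size s).+1 < tau w)%N.
  move=> sw; rewrite ltn_neqAle; apply/andP; split.
    by apply/eqP => e; apply: no; exists w.
  by apply: und; move: sw; rewrite cylinder_rcons => -[].
split=> //.
  have [w sw] := cylinder_nonempty vr.
  by apply: leq_trans (und' w sw) _; have /andP[] := taub w.
apply: ih => //; first by rewrite size_rcons addSnnS.
by rewrite size_rcons.
Qed.

Lemma Rintegral_reward_stop tau s r :
  (forall w, cylinder X (rcons s r) w -> tau w = (size s).+1) ->
  \int[P]_(w in cylinder X (rcons s r)) reward tau w =
  g (size s).+1 r * p (rcons s r).
Proof.
move=> st; rewrite -Rintegral_cst; last exact: measurable_cylinder.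
apply: eq_Rintegral => w; rewrite inE => sw; rewrite /reward st//.
by move: sw; rewrite cylinder_rcons => -[_ ->].
Qed.

Lemma Rintegral_gain tau : (0 < n)%N -> TR tau ->
  \int[P]_w gain tau w = \int[P]_w reward tau w.
Proof.
move=> n0 Ttau.
pose Phi s := \int[P]_(w in cylinder X s) gain tau w =
  \int[P]_(w in cylinder X s) reward tau w.
suff : Phi [::] by rewrite /Phi cylinder_nil.
apply: (@stopping_induction _ Phi n0 Ttau) => s vs sn H; rewrite /Phi.
rewrite !Rintegral_cylinder; [|exact: integrable_reward|exact: integrable_gain].
apply: eq_big_nat => r rb.
have vr : rank_seq (rcons s r) by rewrite rank_seq_rcons vs.
have [st|[_ _]//] := H r rb.
rewrite (Rintegral_reward_stop st).
transitivity (\int[P]_(w in cylinder X (rcons s r))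
  q (absolute_rank X n (size s).+1 w)).
  by apply: eq_Rintegral => w; rewrite inE => sw; rewrite /gain st.
(* At the moment of stopping the absolute rank among the observations made is the relative rank [r],
   hence [b] is [r]. *)
rewrite (@Rintegral_absolute_rank (n - (size s).+1) _ _ r) ?size_rcons ?leqnn//.
  by rewrite subnKC.
by move=> w _; rewrite cylinder_rcons => -[_].
Qed.

(* Optimal expected reward when [k > 0] observations are still to come; nothing
   can be gained after the last one, so [value 0] is a dummy and is guarded by
   the test [k' == 0]. *)
Fixpoint value k : R :=
  if k is k'.+1 then
    (\sum_(1 <= r < (n - k')%N.+1)
      (if (k' == 0)%N || (value k' <= g (n - k')%N r)
       then g (n - k')%N r else value k'))
    / (n - k')%N%:R
  else 0.

(** Time runs backward as in [value], so the first disjunct forces stopping at time [n]. The rank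
    enters only through [g], which will place the rule in T(Y). *)
Let stop (k r : nat) := (k == 0)%N || (value k <= g (n - k)%N r).

(** Multiplying by [p s] absorbs the average over the children into their probabilities, which
    matches the sum in [Rintegral_cylinder]. *)
Lemma value_rec s : rank_seq s -> (size s < n)%N ->
  value (n - size s)%N * p s = \sum_(1 <= r < (size s).+2)
    (if stop (n - (size s).+1)%N r then g (size s).+1 r
     else value (n - (size s).+1)%N) * p (rcons s r).
Proof.
move=> vs sn; rewrite -(subnSK sn) /= /stop subKn//.
rewrite mulrAC -mulrA mulr_suml; apply: eq_big_nat => r rb.
by rewrite (@p_rcons s r) ?rank_seq_rcons ?vs// [X in _ * (X / _)]mulrC mulfK.
Qed.

(** At each child the term of [value_rec] is the better of stopping and continuing whenever both are
    possible, and [tau] does one of the two on the whole child. *)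
Lemma Rintegral_reward_le tau : (0 < n)%N -> TR tau ->
  \int[P]_w reward tau w <= value n.
Proof.
move=> n0 Ttau.
pose Phi s := \int[P]_(w in cylinder X s) reward tau w <=
  value (n - size s)%N * p s.
suff : Phi [::] by rewrite /Phi /p cylinder_nil probability_setT subn0 mulr1.
apply: (@stopping_induction _ Phi n0 Ttau) => s vs sn H; rewrite /Phi.
rewrite Rintegral_cylinder; last exact: integrable_reward.
rewrite (value_rec vs)//; apply: ler_sum_nat => r rb.
have [st|[sn1 _]] := H r rb.
  rewrite (Rintegral_reward_stop st) ler_wpM2r//; case: ifPn => //.
  by rewrite /stop negb_or -ltNge => /andP[_ /ltW]; rewrite subKn.
rewrite /Phi size_rcons => /le_trans; apply; rewrite ler_wpM2r//.
(* Continuing requires [(size s).+1 < n], so here [stop] can only mean that the reward reaches the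
   value of continuing. *)
case: ifPn => //; rewrite /stop subn_eq0 leqNgt sn1 /=; rewrite subKn//.
Qed.

(** [find] counts from 0 in a list starting at 1, hence the successor. For positive [n] the search
    succeeds at time [n] at the latest. *)
Definition threshold_rule w : nat :=
  (find (fun t => stop (n - t)%N (relative_rank X t w)) (iota 1 n)).+1.

Lemma threshold_rule_bound w : (0 < n)%N -> (0 < threshold_rule w <= n)%N.
Proof.
move=> n0; rewrite /threshold_rule /= -[leqRHS](size_iota 1 n) -has_find.
by apply/hasP; exists n; rewrite ?mem_iota /stop ?subnn// n0 add1n ltnS leqnn.
Qed.

Lemma threshold_rule_le t w : (0 < t <= n)%N ->
  stop (n - t)%N (relative_rank X t w) -> (threshold_rule w <= t)%N.
Proof.
move=> /andP[t0 tn] st; rewrite leqNgt; apply/negP => tf.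
have := @before_find _ 0%N (fun t => stop (n - t)%N (relative_rank X t w))
  (iota 1 n) t.-1.
by rewrite nth_iota ?add1n ?prednK// st => /(_ _)/negP [].
Qed.

(** Expresses stopping at [t] through the tests up to time [t] alone, the form that adaptedness
    requires. *)
Lemma threshold_ruleE t w : (0 < t <= n)%N ->
  threshold_rule w = t <-> stop (n - t)%N (relative_rank X t w) /\
    forall i, (0 < i < t)%N -> ~~ stop (n - i)%N (relative_rank X i w).
Proof.
move=> /andP[t0 tn]; rewrite /threshold_rule.
set a := fun t => _; have n0 := leq_trans t0 tn.
have hasa : has a (iota 1 n).
  by rewrite has_find size_iota; have /andP[] := threshold_rule_bound w n0.
have fn : (find a (iota 1 n) < n)%N.
  by rewrite -[ltnRHS](size_iota 1 n) -has_find.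
split=> [ft|[at_t nota]].
  have := nth_find 0%N hasa; rewrite nth_iota// add1n ft => at_t.
  split=> // i /andP[i0 it].
  have := @before_find _ 0%N a (iota 1 n) i.-1.
  rewrite nth_iota ?add1n ?prednK//; last by lia.
  by move=> bf; apply/negPf/bf; rewrite -ltnS ft.
apply/eqP; rewrite eqn_leq (@threshold_rule_le t) ?t0//=.
rewrite leqNgt; apply/negP => ft.
have := nth_find 0%N hasa; rewrite nth_iota// add1n.
by apply/negP; apply: nota; rewrite ft.
Qed.

(** $Y_s$ is a function of $R_s$, so every generating event of the smaller filtration is one of the
    larger. *)
Lemma TY_TR tau : TY tau -> TR tau.
Proof.
move=> [taub Ftau]; split=> // t tb.
apply: smallest_sub (Ftau t tb); first exact: smallest_sigma_algebra.
move=> _ [s sb] [B mB <-]; apply: sub_sigma_algebra; exists s => //.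
by exists (g s @^-1` B).
Qed.

Lemma threshold_rule_TY : (0 < n)%N -> TY threshold_rule.
Proof.
move=> n0; split=> [w|t tb]; first exact: threshold_rule_bound.
set G := natural_filtration _ _.
pose S i := [set w | stop (n - i)%N (relative_rank X i w)].
have GS i : (0 < i <= t)%N -> G (S i).
  move=> ib; apply: sub_sigma_algebra; exists i => //.
  (* The test at time [i] is the preimage under $Y_i$ of a half-line, or of the whole line at time
     [n]. *)
  exists [set x : R | (n - i == 0)%N || (value (n - i)%N <= x)].
    case: (n - i == 0)%N => /=.
      by rewrite (_ : mkset _ = setT)//; apply/seteqP; split.
    rewrite (_ : mkset _ = `[value (n - i)%N, +oo[%classic)//.
    by apply/seteqP; split=> x /=; rewrite in_itv/= andbT.
  have /andP[_ it] := ib; have /andP[_ tn] := tb.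
  rewrite setTI /S /stop /=.
  by under [in RHS]eq_fun do rewrite subKn ?(leq_trans it)//.
rewrite (_ : mkset _ =
  S t `&` \bigcap_i (if (0 < i < t)%N then ~` S i else setT)).
  rewrite /G /natural_filtration in GS *; set F := \bigcup_(_ in _) _ in GS *.
  (* [U] is [T] equipped with the sigma-algebra [G], so that closure properties of measurable sets
     apply to it. *)
  pose U := g_sigma_algebraType F.
  have mS i : (0 < i <= t)%N -> measurable (S i : set U) by exact: GS.
  have : measurable ((S t : set U) `&`
      \bigcap_i (if (0 < i < t)%N then ~` (S i : set U) else setT)).
    apply: measurableI.
      by apply: mS; have /andP[-> _] := tb; rewrite /=.
    apply: bigcapT_measurable => i; case: ifPn => // /andP[i0 it].
    by apply: measurableC; apply: mS; rewrite i0 ltnW.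
  exact.
apply/seteqP; split=> w /=.
  move=> /(threshold_ruleE _ tb)[St nS]; split=> // i _ /=.
  by case: ifPn => // ib; apply/negP; exact: nS.
move=> [St nS]; apply/(threshold_ruleE _ tb); split=> // i ib.
by apply/negP; have := nS i I; rewrite /= ib.
Qed.

Lemma Rintegral_reward_threshold : (0 < n)%N ->
  \int[P]_w reward threshold_rule w = value n.
Proof.
move=> n0; have Ttau := TY_TR (threshold_rule_TY n0).
pose Phi s := \int[P]_(w in cylinder X s) reward threshold_rule w =
  value (n - size s)%N * p s.
suff : Phi [::] by rewrite /Phi /p cylinder_nil probability_setT subn0 mulr1.
apply: (@stopping_induction _ Phi n0 Ttau) => s vs sn H; rewrite /Phi.
rewrite Rintegral_cylinder; last exact: integrable_reward.
rewrite (value_rec vs)//; apply: eq_big_nat => r rb.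
(* The decision is constant on the child, so a single outcome tells which branch of [value_rec]
   applies. *)
have [w sw] : exists w, cylinder X (rcons s r) w.
  by apply: cylinder_nonempty; rewrite rank_seq_rcons vs.
have rE : relative_rank X (size s).+1 w = r.
  by move: sw; rewrite cylinder_rcons => -[].
have tb : (0 < (size s).+1 <= n)%N by [].
have [st|[sn1 und ->]] := H r rb.
  rewrite (Rintegral_reward_stop st).
  by have [+ _] := (threshold_ruleE w tb).1 (st w sw); rewrite rE => ->.
rewrite size_rcons ifN//; apply/negP => st.
by have := und w sw; rewrite ltnNge threshold_rule_le// rE.
Qed.

End optimal_stopping.

(** * Transfer of optimality from T(Y) to T(R) *)

Theorem theorem3 (d : measure_display) (T : measurableType d) (R : realType)
    (P : probability T R) (n : nat) (q : nat -> R)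
    (X : nat -> {RV P >-> R}) (tau_star : T -> nat) :
  (0 < n)%N ->
  independent_seq X ->
  identically_distributed X ->
  (forall t, (0 < t)%N -> continuous (cdf (X t))) ->
  let Rk : nat -> T -> nat := relative_rank X in
  let A : nat -> T -> nat := absolute_rank X n in
  let Y : nat -> T -> R := fun t w => rank_reward q n t (Rk t w) in
  let TR := stopping_times n (natural_filtration Rk) in
  let TY := stopping_times n (natural_filtration Y) in
  let EqA := expected_stopped P (fun t w => q (A t w)) in
  let EY := expected_stopped P Y in
  maximizer TY EY tau_star ->
  maximizer TR EqA tau_star /\
  exists v : R,
    [/\ EqA tau_star = v%:E,
        maximum_of (EqA @` TR) v%:E,
        maximum_of (EY @` TY) v%:E
      & EY tau_star = v%:E].
Proof.
move=> n0 indX idX ctsX Rk A Y TR TY EqA EY [TYstar [_ EYstar]].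
have ER tau : TR tau -> EY tau = (\int[P]_w Y (tau w) w)%:E.
  move=> Ttau; rewrite /EY /expected_stopped unlock fineK//.
  exact/integrable_fin_num/integrable_reward.
have EA tau : TR tau -> EqA tau = EY tau.
  move=> Ttau; rewrite ER// -(Rintegral_gain q indX idX ctsX n0 Ttau).
  rewrite /EqA /expected_stopped unlock fineK//.
  exact/integrable_fin_num/integrable_gain.
have TRstar : TR tau_star by exact: TY_TR TYstar.
(* The threshold rule is the link: it is at least as good as every rule in T(R), and [tau_star] is
   at least as good as it because it lies in T(Y). *)
have le_star tau : TR tau -> (EY tau <= EY tau_star)%E.
  move=> Ttau; apply: (@le_trans _ _ (EY (threshold_rule n q X))).
    have T0 := threshold_rule_TY q X n0.
    rewrite !ER//; last exact: TY_TR T0.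
    rewrite lee_fin (Rintegral_reward_threshold q indX idX ctsX n0).
    exact: Rintegral_reward_le.
  apply: EYstar; exists (threshold_rule n q X) => //.
  exact: threshold_rule_TY.
have maxA : maximum_of (EqA @` TR) (EqA tau_star).
  split; first by exists tau_star.
  by move=> _ [tau Ttau <-]; rewrite !EA// le_star.
split; first by split.
exists (\int[P]_w Y (tau_star w) w); rewrite -ER//.
by split=> //; [exact: EA|rewrite -EA].
Qed.
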